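(* Let $S$ be an infinite set and let $A\in(\mathbb{R}\cup\{-\infty\})^{S\times S}$ be such that $\rho(A)\in\mathbb{R}$. Assume that $A$ is irreducible, that $\tilde A$ has Property (T), and that $N^c(A)\neq\emptyset$. Then, for all $i,j\in S$, there exists $m_{ij}\in\mathbb{N}$ having the following property: any path in $G(A)$ from $i$ to $j$ having maximal weight amongst all paths with the same ends and the same length has at most $m_{ij}$ non-critical nodes (counted with multiplicity along the path).
   Context: Write $\overline{\mathbb{R}}=\mathbb{R}\cup\{-\infty,+\infty\}$, with the convention $(-\infty)+(+\infty)=-\infty$; the supremum of the empty set is $-\infty$; $\mathbb{N}=\{0,1,2,\dots\}$. For $B,C\in\overline{\mathbb{R}}^{S\times S}$ the (max-plus) product is $(BC)_{ij}=\sup_{k\in S}(B_{ik}+C_{kj})$; $B^0=I$ is the matrix with $0$ on the diagonal and $-\infty$ elsewhere, and $B^*_{ij}:=\sup_{n\ge0}(B^n)_{ij}$. $G(A)$ is the digraph with node set $S$ and an arc $i\to j$ whenever $A_{ij}\ne-\infty$; $A$ is irreducible if $G(A)$ is strongly connected. A path $p=(i_0,\dots,i_n)$ in $G(A)$ has length $|p|=n$ and weight $|p|_A=\sum_{t=0}^{n-1}A_{i_ti_{t+1}}$; a circuit is a path of length $\ge1$ with $i_0=i_n$. The maximal circuit mean is $\rho(A):=\sup_{c}|c|_A/|c|$ over all circuits $c$ of $G(A)$. When $\rho(A)\in\mathbb{R}$, $\tilde A_{ij}:=A_{ij}-\rho(A)$. The critical graph $G^c(A)$ is the subgraph of $G(A)$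 which is the union (nodes and arcs) of all circuits $c$ with $|c|_A/|c|=\rho(A)$; its set of nodes is denoted $N^c(A)$ (critical nodes). A node is non-critical if it is not in $N^c(A)$. A map $v:S\to\overline{\mathbb{R}}$ is tight if $v_j\neq+\infty$ for all $j$ and $\{j\in S: v_j\ge\beta\}$ is finite for every $\beta\in\mathbb{R}$. A vector $u\in\overline{\mathbb{R}}^S$ is $B$-tight if for each $i\in S$ the map $j\mapsto B_{ij}+u_j$ is tight. A matrix $B$ has Property (T) if all columns of $B^*$ are $B^*$-tight, i.e. for all $i,j\in S$ the map $k\mapsto B^*_{ik}+B^*_{kj}$ is tight. *)

(* Defs.v *)
From HB Require Import structures.
From mathcomp Require Import all_boot all_order all_algebra.
From mathcomp Require Import all_classical all_reals ereal.
Set Implicit Arguments.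
Unset Strict Implicit.
Unset Printing Implicit Defensive.
Import Order.TTheory GRing.Theory Num.Theory.
Local Open Scope classical_set_scope.
Local Open Scope ring_scope.
Local Open Scope ereal_scope.

(* Possibly infinite matrices over \bar R are functions S -> S -> \bar R.     *)
(* The addition of \bar R satisfies -oo + +oo = -oo, and ereal_sup set0 = -oo.*)
Section MaxPlusMatrices.
Context {R : realType} {S : choiceType}.
Implicit Types (B C : S -> S -> \bar R) (v u : S -> \bar R).

Definition mp_mul B C : S -> S -> \bar R :=
  fun i j => ereal_sup (range (fun k => B i k + C k j)).

Definition mp_id : S -> S -> \bar R := fun i j => if i == j then 0 else -oo.

Definition mp_exp B (n : nat) : S -> S -> \bar R := iter n (mp_mul B) mp_id.

Definition mp_star B : S -> S -> \bar R :=
  fun i j => ereal_sup (range (fun n => mp_exp B n i j)).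

Definition tight v : Prop :=
  (forall j, v j != +oo) /\
  (forall beta : R, finite_set [set j | beta%:E <= v j]).

Definition tight_for B u : Prop := forall i, tight (fun j => B i j + u j).

Definition property_T B : Prop :=
  forall j, tight_for (mp_star B) (fun k => mp_star B k j).

End MaxPlusMatrices.

(* A path (i_0, ..., i_n) is given by its origin i = i_0 and the sequence     *)
(* p = [:: i_1; ...; i_n]; its length n is size p, its end is last i p and    *)
(* its sequence of nodes is i :: p.                                           *)
Section Graph.
Context {R : realType} {S : choiceType}.
Implicit Types (A : S -> S -> \bar R) (i j : S) (p : seq S).

Definition arc A : rel S := fun i j => A i j != -oo.

Definition path_from_to A i j p : Prop := path (arc A) i p /\ last i p = j.

Definition irreducible A : Prop := forall i j, exists p, path_from_to A i j p.

Definition weight A i p : \bar R :=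
  \sum_(t < size p) A (nth i (i :: p) t) (nth i (i :: p) t.+1).

Definition circuit A i p : Prop := (0 < size p)%N /\ path_from_to A i i p.

Definition circuit_mean A i p : \bar R :=
  weight A i p * ((size p)%:R^-1)%:E.

Definition max_circuit_mean A : \bar R :=
  ereal_sup [set r | exists i p, circuit A i p /\ r = circuit_mean A i p].

Definition normalized A : S -> S -> \bar R :=
  fun i j => A i j - max_circuit_mean A.

Definition critical_circuit A i p : Prop :=
  circuit A i p /\ circuit_mean A i p = max_circuit_mean A.

(* The nodes of the critical graph. *)
Definition critical_nodes A : set S :=
  [set k | exists i p, critical_circuit A i p /\ k \in i :: p].

Definition max_weight_path A i j p : Prop :=
  path_from_to A i j p /\
  forall q, path_from_to A i j q -> size q = size p ->
    weight A i q <= weight A i p.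

Definition nb_noncritical A i p : nat :=
  count (fun k => k \notin critical_nodes A) (i :: p).

End Graph.

(* Main.v *)
(* Normalize so that the maximal circuit mean is 0. Given j, the finite vector
   u_k = A^*_kj satisfies A_kl + u_l <= u_k, so the weight of a path is
   u_start - u_end minus the sum of the nonnegative slacks of its arcs.
   - Maximal weight paths from i to j have weight bounded below: in each residue
     class modulo the length of a fixed critical circuit, one path through that
     circuit is extended to all larger lengths, at no cost, by winding around it.
   - Hence, by Property (T), all their nodes lie in a finite set of nodes k
     with A^*_ik + A^*_kj >= beta. There the positive slacks are bounded away
     from 0, so the number of arcs with positive slack is bounded.
   - A circuit of zero-slack arcs is critical, so a non-critical node is visited
     at most once more than the number of arcs with positive slack. *)
Require Import Defs.
From HB Require Import structures.
From mathcomp Require Import all_boot all_order all_algebra.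
From mathcomp Require Import all_classical all_reals ereal.
From mathcomp Require Import ring lra zify.
Set Implicit Arguments.
Unset Strict Implicit.
Unset Printing Implicit Defensive.
Import Order.TTheory GRing.Theory Num.Theory.
Local Open Scope classical_set_scope.
Local Open Scope ring_scope.
Local Open Scope ereal_scope.

(** * Counting the visits of a walk to a node *)

Fixpoint nb_nonarcs (T : Type) (e : rel T) (x : T) (p : seq T) : nat :=
  if p is y :: p' then (~~ e x y + nb_nonarcs e y p')%N else 0%N.

(* Between two visits to [k] the walk must use a pair outside [e]. *)
Lemma count_mem_le_nb_nonarcs (T : eqType) (e : rel T) (k : T) :
  (forall p, p != [::] -> path e k p -> last k p != k) ->
  forall x p, (count_mem k (x :: p) <= (nb_nonarcs e x p).+1)%N.
Proof.
move=> acyc.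
(* The second clause strengthens the induction: once [x] is reached from a visit to [k] inside [e],
   even the next visit costs a pair outside [e], so the extra 1 disappears. *)
have main p : forall x, (count_mem k p <= (nb_nonarcs e x p).+1)%N /\
  ((exists2 q, path e k q & last k q = x) ->
     (count_mem k p <= nb_nonarcs e x p)%N).
  elim: p => [//|y p IH] x /=; have [IH1 IH2] := IH y.
  have IHk : y = k -> (count_mem k p <= nb_nonarcs e y p)%N.
    by move=> yk; apply: IH2; exists [::].
  split.
    have [/IHk|_] := eqVneq y k; first by lia.
    by apply: leq_trans IH1 _; rewrite ltnS leq_addl.
  move=> [q eq lastq]; case exy: (e x y) => /=.
    have yk : y != k.
      have := acyc (rcons q y); rewrite last_rcons; apply; first by case: (q).
      by rewrite rcons_path eq lastq.
    rewrite (negPf yk) !add0n; apply: IH2; exists (rcons q y).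
      by rewrite rcons_path eq lastq.
    by rewrite last_rcons.
  by have [/IHk|_] := eqVneq y k; [lia|rewrite add0n add1n].
move=> x p /=; have [m1 m2] := main p x.
have [xk|_] := eqVneq x k; last by rewrite add0n.
by rewrite add1n ltnS; apply: m2; exists [::].
Qed.

Lemma count_le_sum_count_mem (T : eqType) (P : pred T) (s t : seq T) :
  {subset t <= s} ->
  (count P t <= \sum_(k <- s | P k) count_mem k t)%N.
Proof.
elim: t => [//|x t IH] ts /=.
have /IH {}IH : {subset t <= s} by move=> k kt; apply: ts; rewrite in_cons kt orbT.
rewrite big_split /=; apply: leq_add => //.
have [Px|//] := boolP (P x); have xs : x \in s by apply: ts; rewrite mem_head.
by rewrite (big_rem x) //= Px eqxx leq_addr.
Qed.

Lemma positive_lower_bound (R : realType) (s : seq R) :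
  exists2 d : R, (0 < d)%R & forall x, x \in s -> (0 < x)%R -> (d <= x)%R.
Proof.
elim: s => [|y s [d d0 ds]]; first by exists 1%R.
have [y0|y0] := ltP 0%R y.
  exists (Num.min d y); first by rewrite lt_min d0.
  by move=> x /[!inE] /orP[/eqP->|xs] x0; rewrite ge_min ?lexx ?orbT// ds.
exists d => // x /[!inE] /orP[/eqP->|xs] x0; last exact: ds.
by rewrite ltNge y0 in x0.
Qed.

(** * Real path weights and potentials *)

Section RealWeight.
Context {R : realType} {S : choiceType}.
Implicit Types (a : S -> S -> R) (u : S -> R) (x y : S) (p q : seq S).

Fixpoint rweight a x p : R :=
  if p is y :: p' then (a x y + rweight a y p')%R else 0%R.

Lemma rweight_cat a x p q :
  rweight a x (p ++ q) = (rweight a x p + rweight a (last x p) q)%R.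
Proof. by elim: p x => [|y p IH] x /=; rewrite ?add0r// IH addrA. Qed.

(** The reduced cost of the arc for the potential [u]. *)
Definition slack a u x y : R := (u x - (a x y + u y))%R.

(** The differences of [u] telescope along the path. *)
Lemma rweight_slack a u x p :
  rweight a x p = (u x - u (last x p) - rweight (slack a u) x p)%R.
Proof.
elim: p x => [|y p IH] x /=; first by rewrite !subrr.
by rewrite IH /slack; ring.
Qed.

End RealWeight.

Lemma path_cycle_iter (T : Type) (e : rel T) (x : T) (c : seq T) (m : nat) :
  path e x c -> last x c = x ->
  path e x (flatten (nseq m c)) /\ last x (flatten (nseq m c)) = x.
Proof.
by move=> xc cx; elim: m => //= m [IH1 IH2]; rewrite cat_path last_cat xc cx.
Qed.

Lemma size_flatten_nseq (T : Type) (c : seq T) (m : nat) :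
  size (flatten (nseq m c)) = (m * size c)%N.
Proof. by elim: m => //= m IH; rewrite size_cat IH mulSn. Qed.

Lemma rweight_cycle_iter (R : realType) (S : choiceType) (a : S -> S -> R)
    (x : S) (c : seq S) (m : nat) :
  last x c = x -> rweight a x c = 0%R ->
  rweight a x (flatten (nseq m c)) = 0%R.
Proof.
by move=> cx c0; elim: m => //= m IH; rewrite rweight_cat cx c0 IH addr0.
Qed.

(* The real matrix that agrees with [normalized A] on the arcs of [A]; off the
   arcs its entries are junk. *)
Definition rnormalized (R : realType) (S : choiceType) (A : S -> S -> \bar R)
  (i j : S) : R := (fine (A i j) - fine (max_circuit_mean A))%R.

(** * The star of the normalized matrix and critical circuits *)

Section MaxPlus.
Context {R : realType} {S : choiceType} (A : S -> S -> \bar R).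
Context (A_lty : forall i j, A i j != +oo).
Context (rho_real : max_circuit_mean A \is a fin_num).

Lemma arc_fineK i j : Defs.arc A i j -> A i j = (fine (A i j))%:E.
Proof. by move=> ij; rewrite fineK// fin_numE A_lty andbT. Qed.

Lemma normalized_arc i j : Defs.arc A i j -> normalized A i j = (rnormalized A i j)%:E.
Proof.
by move=> /arc_fineK ij; rewrite /normalized ij -(fineK rho_real) -EFinB.
Qed.

Lemma weight_rweight i p : path (Defs.arc A) i p ->
  weight A i p =
  (rweight (rnormalized A) i p + fine (max_circuit_mean A) * (size p)%:R)%:E.
Proof.
(* In [weight] the default of [nth] is the origin, which changes in the induction; hence an
   arbitrary default [d]. *)
suff main d : path (Defs.arc A) i p ->
    \sum_(t < size p) A (nth d (i :: p) t) (nth d (i :: p) t.+1) =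
    (rweight (rnormalized A) i p + fine (max_circuit_mean A) * (size p)%:R)%:E.
  exact: main.
elim: p i => [|y p IH] i /=.
  by rewrite big_ord0 mulr0 addr0.
move=> /andP[iy yp]; rewrite big_ord_recl /= arc_fineK//.
rewrite (eq_bigr (fun t : 'I_(size p) =>
  A (nth d (y :: p) t) (nth d (y :: p) t.+1)))//.
rewrite IH//. rewrite -EFinD; congr (_ %:E); rewrite /rnormalized -natr1; ring.
Qed.

Lemma critical_circuitE i p : circuit A i p ->
  (critical_circuit A i p <-> rweight (rnormalized A) i p = 0%R).
Proof.
move=> ip; have [p0 [ap _]] := ip.
have p0' : ((size p)%:R != 0 :> R)%R by rewrite pnatr_eq0 -lt0n.
rewrite /critical_circuit /circuit_mean weight_rweight// -EFinM.
rewrite -{2}(fineK rho_real); split=> [[_ cm]|w0].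
  move: (EFin_inj cm); by rewrite mulrDl mulfK// => /eqP; rewrite -subr_eq0 addrK mulf_eq0
    invr_eq0 (negPf p0') orbF => /eqP.
by split=> //; rewrite w0 add0r mulfK.
Qed.

Lemma rweight_le_mp_star i p : path (Defs.arc A) i p ->
  (rweight (rnormalized A) i p)%:E <= mp_star (normalized A) i (last i p).
Proof.
move=> ip; apply: (@le_trans _ _ (mp_exp (normalized A) (size p) i (last i p)));
  last by apply: ereal_sup_ubound; exists (size p).
elim: p i ip => [|y p IH] i /=; first by rewrite /mp_exp /= /mp_id eqxx.
move=> /andP[iy yp]; rewrite EFinD -normalized_arc//.
apply: (@le_trans _ _ (normalized A i y +
    mp_exp (normalized A) (size p) y (last y p))).
  by rewrite leeD2l// IH.
by apply: ereal_sup_ubound; exists y.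
Qed.

(** Prepending the arc raises the exponent from [n] to [n.+1]. Columns of the star thus serve as
    potentials with nonnegative slacks. *)
Lemma mp_star_arc k l j : Defs.arc A k l ->
  (rnormalized A k l)%:E + mp_star (normalized A) l j <=
  mp_star (normalized A) k j.
Proof.
move=> kl; rewrite -leeBrDl//.
apply: ub_ereal_sup => _ [n _ <-]; rewrite leeBrDl//.
apply: (@le_trans _ _ (mp_exp (normalized A) n.+1 k j));
  last by apply: ereal_sup_ubound; exists n.+1.
by rewrite -normalized_arc//; apply: ereal_sup_ubound; exists l.
Qed.

(** A path from [i] to [j] excludes [-oo]. Tightness excludes [+oo] for the entry [i j] plus the
    entry [j j]; the latter is at least 0 by the empty path, so it cannot absorb a [+oo]. *)
Lemma mp_star_fin_num (A_irr : irreducible A)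
    (A_T : property_T (normalized A)) i j :
  mp_star (normalized A) i j \is a fin_num.
Proof.
have [p [ip pj]] := A_irr i j.
have := rweight_le_mp_star ip; rewrite pj => ijge.
rewrite fin_numE; apply/andP; split.
  by rewrite -ltNye (lt_le_trans (ltNyr _) ijge).
have /(_ j) := (A_T j i).1; apply: contra => /eqP ->.
have /= := @rweight_le_mp_star j [::] isT.
by case: (mp_star _ j j).
Qed.

(** Around a closed path the potential cancels, so zero slacks force normalized weight 0. This is
    the acyclicity that [count_mem_le_nb_nonarcs] asks for. *)
Lemma noncritical_slack u k p : k \notin critical_nodes A ->
  p != [::] ->
  path (fun x y => Defs.arc A x y && (slack (rnormalized A) u x y == 0%R)) k p ->
  last k p != k.
Proof.
move=> kN p0 kp; apply: contra kN => /eqP pk; rewrite inE.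
have /andP[akp /eqP w0] : path (Defs.arc A) k p &&
    (rweight (slack (rnormalized A) u) k p == 0%R).
  elim: p k kp {p0 pk} => [|y p IH] k /=; first by rewrite eqxx.
  move=> /andP[/andP[-> /eqP ->] /IH /andP[-> /eqP ->]].
  by rewrite addr0 eqxx.
have kpc : circuit A k p by split; [rewrite lt0n size_eq0|split].
exists k, p; split; last by rewrite mem_head.
by apply/(critical_circuitE kpc); rewrite (rweight_slack _ u) pk w0 !subrr.
Qed.

Lemma nb_noncritical_bounded (u : S -> R) (s : seq S) (M : R) :
  (forall k l, Defs.arc A k l -> (rnormalized A k l + u l <= u k)%R) ->
  exists m : nat, forall i p, path (Defs.arc A) i p -> {subset i :: p <= s} ->
    (u i - u (last i p) - rweight (rnormalized A) i p <= M)%R ->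
    (nb_noncritical A i p <= m)%N.
Proof.
move=> feas.
have [d d0 ds] :=
  positive_lower_bound [seq slack (rnormalized A) u x y | x <- s, y <- s].
pose e x y := Defs.arc A x y && (slack (rnormalized A) u x y == 0%R).
have nbd p : forall i, path (Defs.arc A) i p -> {subset i :: p <= s} ->
    (d * (nb_nonarcs e i p)%:R <= rweight (slack (rnormalized A) u) i p)%R.
  elim: p => [|y p IH] i /=; first by rewrite mulr0.
  move=> /andP[iy yp] ips; rewrite natrD mulrDr lerD//; last first.
    by apply: IH => // k ky; apply: ips; rewrite in_cons ky orbT.
  have sl0 : (0 <= slack (rnormalized A) u i y)%R by rewrite subr_ge0 feas.
  rewrite /e iy /=; case: eqVneq => [->|sl]; first by rewrite mulr0.
  rewrite mulr1 ds//; last by rewrite lt_neqAle eq_sym sl.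
  by apply: allpairs_f; apply: ips; rewrite !inE eqxx ?orbT.
pose P k := k \notin critical_nodes A.
(* Each pair outside [e] uses at least [d] of a total slack of at most [M]; the successor accounts
   for the first visit to [k]. *)
exists (\sum_(k <- s | P k) (Num.bound (M / d)).+1)%N => i p ip ips leM.
have le1 := count_le_sum_count_mem P ips.
apply: leq_trans le1 _; apply: leq_sum => k Pk.
apply: (@leq_trans (nb_nonarcs e i p).+1).
  by apply: count_mem_le_nb_nonarcs => q q0 kq; apply: noncritical_slack kq.
have nM : (d * (nb_nonarcs e i p)%:R <= M)%R.
  by apply: le_trans (nbd _ _ ip ips) _; rewrite (rweight_slack _ u) in leM; lra.
have nMd : ((nb_nonarcs e i p)%:R <= M / d)%R by rewrite ler_pdivlMr// mulrC.
rewrite ltnS -(ler_nat R); apply: le_trans (nMd) _; apply/ltW.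
apply: archi_boundP; apply: le_trans nMd; exact: ler0n.
Qed.

End MaxPlus.

(** * Lower bound on maximal weights in a residue class of lengths *)

Section LowerBound.
Context {R : realType} {S : choiceType} (A : S -> S -> \bar R).
Context (A_lty : forall i j, A i j != +oo).
Context (rho_real : max_circuit_mean A \is a fin_num).
Context (A_irr : irreducible A).

(* Following [p] by [l] copies of the closed walk [j -> x -> j] leaves the
   length unchanged modulo [l]. *)
Lemma path_through (l : nat) x i j p : (0 < l)%N -> path_from_to A i j p ->
  exists q1 q2, [/\ path_from_to A i x q1, path_from_to A x j q2 &
    (size q1 + size q2 = size p %[mod l])%N].
Proof.
case: l => [//|l] _ [ip pj].
have [s [js sx]] := A_irr j x; have [t [xt tj]] := A_irr x j.
have [jst jst'] : path (Defs.arc A) j (flatten (nseq l (s ++ t))) /\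
    last j (flatten (nseq l (s ++ t))) = j.
  by apply: path_cycle_iter; rewrite ?cat_path ?last_cat ?sx ?js.
exists (p ++ s), (t ++ flatten (nseq l (s ++ t))).
rewrite /path_from_to !cat_path !last_cat pj sx tj jst' ip js xt jst; split=> //.
rewrite !size_cat size_flatten_nseq size_cat.
rewrite (_ : (_ + _ = (size s + size t) * l.+1 + size p)%N); last by ring.
by rewrite modnMDl.
Qed.

Lemma max_weight_path_lower_bound x c i j r : critical_circuit A x c ->
  exists N (beta : R), forall p, max_weight_path A i j p ->
    (size p = r %[mod size c])%N -> (N <= size p)%N ->
    (beta <= rweight (rnormalized A) i p)%R.
Proof.
move=> xc; have [[c0 [xcp cx]] _] := xc.
have [[p0 [ip0 p0r]]|nop] :=
    pselect (exists p, path_from_to A i j p /\ (size p = r %[mod size c])%N);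
  last by exists 0%N, 0%R => p [ip _] pr; case: nop; exists p.
have [q1 [q2 [[iq1 q1x] [xq2 q2j] q12]]] := path_through x c0 ip0.
(* Threshold and bound are the length and the normalized weight of [q1 ++ q2], a path through [x] in
   the residue class of [r]. *)
exists (size q1 + size q2)%N.
exists (rweight (rnormalized A) i q1 + rweight (rnormalized A) x q2)%R.
move=> p [[ip pj] pmax] pr Np.
have /dvdnP[m pm] : (size c %| size p - (size q1 + size q2))%N.
  by rewrite -eqn_mod_dvd// q12 p0r pr.
have [xcm xcm'] := path_cycle_iter m xcp cx.
(* Copies of the critical circuit, of normalized weight 0, stretch [q1 ++ q2] to the length of
   [p]. *)
pose q := q1 ++ flatten (nseq m c) ++ q2.
have iq : path (Defs.arc A) i q by rewrite !cat_path iq1 q1x xcm xcm' xq2.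
have sq : size q = size p.
  by rewrite !size_cat size_flatten_nseq -pm; lia.
have : weight A i q <= weight A i p.
  by apply: pmax => //; split=> //; rewrite !last_cat q1x xcm'.
rewrite !weight_rweight// sq lee_fin lerD2r; apply: le_trans.
rewrite !rweight_cat q1x xcm' rweight_cycle_iter ?add0r//.
by apply/(critical_circuitE A_lty rho_real xc.1).
Qed.

End LowerBound.

Theorem theorem7p5 (R : realType) (S : choiceType) (A : S -> S -> \bar R)
    (S_infinite : infinite_set [set: S])
    (A_lty : forall i j, A i j != +oo)
    (rho_real : max_circuit_mean A \is a fin_num)
    (A_irr : irreducible A)
    (A_T : property_T (normalized A))
    (Nc_neq0 : critical_nodes A !=set0) :
  forall i j : S, exists m : nat, forall p : seq S,
    max_weight_path A i j p -> (nb_noncritical A i p <= m)%N.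
Proof.
move=> i j; have [_ [x [c [xc _]]]] := Nc_neq0.
have starK k l := mp_star_fin_num A_lty rho_real A_irr A_T k l.
pose U k l : R := fine (mp_star (normalized A) k l).
have starE k l : mp_star (normalized A) k l = (U k l)%:E by rewrite fineK.
have bounded (r : nat) : exists m : nat, forall p, max_weight_path A i j p ->
    (size p = r %[mod size c])%N -> (nb_noncritical A i p <= m)%N.
  have [N [beta betaP]] :=
    max_weight_path_lower_bound A_lty rho_real A_irr i j r xc.
  have /finite_seqP[s sE] := (A_T j i).2 beta.
  have feas k l : Defs.arc A k l -> (rnormalized A k l + U l j <= U k j)%R.
    move=> /(mp_star_arc A_lty rho_real j).
    by rewrite !starE -EFinD lee_fin.
  (* For the potential [U k j] in [k], a path of normalized weight at least [beta] has total slack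
     at most [U i j - U j j - beta]. *)
  have [m mP] :=
    nb_noncritical_bounded A_lty rho_real s (U i j - U j j - beta)%R feas.
  (* A path of length less than [N] has at most [N] nodes in all. *)
  exists (maxn N m) => p ijp pr; rewrite leq_max.
  have [pN|Np] := ltnP (size p) N.
    by rewrite (leq_trans (count_size _ _)).
  have [[ip pj] _] := ijp; have betap := betaP _ ijp pr Np.
  apply/orP; right; apply: mP => //; last by rewrite pj lerB.
  (* Cut [p] at [k]: the pieces weigh at most [U i k] and [U k j], whose sum is therefore at least
     [beta]. *)
  move=> k kip; suff : [set` s] k by [].
  rewrite -sE /= !starE -EFinD lee_fin; apply: le_trans betap _.
  have [p1 [p2 [pE p1k]]] : exists p1 p2, p = p1 ++ p2 /\ last i p1 = k.
    by case/splitPl: kip => p1 p2 p1k; exists p1, p2.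
  move: ip pj; rewrite pE cat_path rweight_cat last_cat p1k => /andP[ip1 kp2] p2j.
  apply: lerD; rewrite -lee_fin -starE.
    by rewrite -p1k; apply: rweight_le_mp_star.
  by rewrite -p2j; apply: rweight_le_mp_star.
have [m mP] := choice bounded.
(* Only finitely many residues modulo [size c] occur. *)
exists (\max_(r < size c) m r) => p ijp.
have c0 : (size p %% size c < size c)%N by rewrite ltn_mod xc.1.1.
apply: leq_trans (leq_bigmax (Ordinal c0)).
by apply: mP => //; rewrite modn_mod.
Qed.
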